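(* Suppose that $G\in\mathcal{P}$, that $\mu$ is a Borel measure on $(0,1)$, and that $\mathcal{P}_0\subseteq\mathcal{P}$ is a class of distributions such that the expected score $\mathbb{E}_G\, \mathrm{GDS}(F,Y;G,\mu)$ is finite for all $F\in\mathcal{P}_0$. Then the generalized diagonal score $\mathrm{GDS}(\cdot,\cdot\,;G,\mu):\mathcal{P}_0\times I\to[0,\infty]$ is equitable with respect to $G$, with equitability constant $$c=\int_{\mathcal{R}(G)}\alpha(1-\alpha)\,\mathrm{d}\mu(\alpha).$$
   Context: Let $I\subseteq\mathbb{R}$ be an interval (the set of possible values of the observation). $\mathcal{P}$ is the class of Borel probability measures on $\mathbb{R}$ with mass concentrated in $I$; each $F\in\mathcal{P}$ is identified with its right-continuous CDF. $\mathbb{E}_F h(Y)$ denotes the expectation of $h(Y)$ when $Y$ has distribution $F$. The measure $\mu$ is not necessarily a probability measure. $\mathbf{1}$ denotes the indicator function. For $F\in\mathcal{P}$ and $\alpha\in(0,1)$, $F^{-1}(\alpha)=\min\{z\in\mathbb{R}:F(z)\ge\alpha\}$. For $G\in\mathcal{P}$, $\mathcal{R}(G)=\{\alpha\in(0,1): G(z)=\alpha \text{ for some } z\in\mathbb{R}\}$. For $\alpha\in(0,1)$ and $\theta\in I$, the elementary scoring function $S_{\alpha,\theta}:I\times I\to[0,1)$ is $$S_{\alpha,\theta}(x,y)=(\mathbf{1}\{y<x\}-\alpha)(\mathbf{1}\{\theta<x\}-\mathbf{1}\{\theta<y\}),$$ i.e. it equals $\alpha$ if $x\le\theta<y$, $1-\alpha$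 if $x>\theta\ge y$, and $0$ otherwise. The generalized diagonal score $\mathrm{GDS}(\cdot,\cdot\,;G,\mu):\mathcal{P}\times I\to[0,\infty]$ is $$\mathrm{GDS}(F,y;G,\mu)=\int_{\mathcal{R}(G)}S_{\alpha,G^{-1}(\alpha)}(F^{-1}(\alpha),y)\,\mathrm{d}\mu(\alpha).$$ A scoring function $S:\mathcal{F}\times\mathcal{O}\to[-\infty,\infty]$ is equitable with respect to a probability distribution $G$ on $\mathcal{O}$ if there is a constant $c\in\mathbb{R}$ such that $\mathbb{E}_G S(x,Y)=c$ for every $x\in\mathcal{F}$; $c$ is called the equitability constant. *)

(* Defs.v *)
From HB Require Import structures.
From mathcomp Require Import all_boot all_order all_algebra.
From mathcomp Require Import all_classical all_reals all_analysis.

Set Implicit Arguments.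
Unset Strict Implicit.
Unset Printing Implicit Defensive.

Import Order.TTheory GRing.Theory Num.Theory.
Import numFieldNormedType.Exports.

Local Open Scope classical_set_scope.
Local Open Scope ring_scope.

Notation distr R := (probability (measurableTypeR R) R).

Notation borel_measure R := {measure set (measurableTypeR R) -> \bar R}.

(* Borel measures on a Borel set A are represented by the Borel measures on R
   that vanish off A. *)
Definition concentrated_on (R : realType) (mu : borel_measure R) (A : set R) :=
  mu (~` A) = 0%E.

Definition distributions_on (R : realType) (I : interval R) : set (distr R) :=
  [set F | concentrated_on F [set` I]].

Definition CDF (R : realType) (F : distr R) (z : R) : R :=
  fine (F `]-oo, z]%classic).

(* For alpha in ]0, 1[ this infimum is a minimum, see quantile_min below. *)
Definition quantile (R : realType) (F : distr R) (alpha : R) : R :=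
  inf [set z | alpha <= CDF F z].

Definition cdf_range (R : realType) (G : distr R) : set R :=
  [set alpha | 0 < alpha < 1 /\ exists z, CDF G z = alpha].

Definition elementary_score (R : realType) (alpha theta x y : R) : R :=
  ((y < x)%R%:R - alpha) * ((theta < x)%R%:R - (theta < y)%R%:R).

Definition GDS (R : realType) (G : distr R) (mu : borel_measure R)
    (F : distr R) (y : R) : \bar R :=
  (\int[mu]_(alpha in cdf_range G)
    (elementary_score alpha (quantile G alpha) (quantile F alpha) y)%:E)%E.

(* T is the type of forecasts, Fc the class of admissible ones and O the
   observation domain.  Integrability is what it means for the expected score
   of an extended real-valued score to exist and be a real number: the
   integral by itself is defined for every function. *)
Definition equitable_with (R : realType) (T : Type) (Fc : set T) (O : set R)
    (S : T -> R -> \bar R) (G : distr R) (c : R) :=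
  forall x, Fc x -> G.-integrable O (S x) /\
                    (\int[G]_(y in O) S x y = c%:E)%E.

Section quantile_min.
Variables (R : realType) (F : distr R).

Let idT : measurableTypeR R -> R := idfun.

#[local] HB.instance Definition _ :=
  @isMeasurableFun.Build _ _ _ _ idT (@measurable_id _ _ setT).

Let CDFE z : (CDF F z)%:E = cdf (idT : {RV F >-> R}) z.
Proof. by rewrite /CDF fineK ?fin_num_measure. Qed.

Let CDF_nd : {homo CDF F : x y / x <= y}.
Proof. by move=> x y xy; rewrite -lee_fin !CDFE; exact: cdf_nondecreasing. Qed.

Lemma quantile_min (alpha : R) : 0 < alpha < 1 ->
  alpha <= CDF F (quantile F alpha) /\
  forall z, alpha <= CDF F z -> quantile F alpha <= z.
Proof.
move=> /andP[a0 a1]; set A := [set z | alpha <= CDF F z].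
have cdfE : fine \o cdf (idT : {RV F >-> R}) = CDF F.
  by apply/funext => z /=; rewrite -CDFE.
have A0 : A !=set0.
  have /fine_cvg/cvgr_ge := @cvg_cdfy1 _ _ _ F idT.
  rewrite cdfE => /(_ _ a1)[M [_ h]].
  by exists (M + 1); apply: h; rewrite ltrDl.
have Alb : has_lbound A.
  have /fine_cvg/cvgr_lt := @cvg_cdfNy0 _ _ _ F idT.
  rewrite cdfE => /(_ _ a0)[M [_ h]].
  exists M => z /= az; rewrite leNgt; apply/negP => zM.
  by have := lt_le_trans (h z zM) az; rewrite ltxx.
split; last by move=> z az; exact: ge_inf.
rewrite leNgt; apply/negP => qa.
have := @cdf_right_continuous _ _ _ F idT (inf A).
rewrite -CDFE => /fine_cvg/cvgr_lt.
rewrite cdfE => /(_ _ qa)[e /= e0 h].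
have [z Az zq] := inf_adherent (divr_gt0 e0 (@ltr0n R 2)) (conj A0 Alb).
have /h : ball (inf A) e (inf A + e / 2).
  by rewrite /ball /= opprD addrA subrr sub0r normrN gtr0_norm ?divr_gt0//
    ltr_pdivrMr// ltr_pMr// ltr1n.
rewrite ltrDl divr_gt0// => /(_ isT); apply/negP; rewrite -leNgt.
exact: le_trans Az (CDF_nd (ltW zq)).
Qed.

End quantile_min.

(* Main.v *)
Require Import Defs.
From HB Require Import structures.
From mathcomp Require Import all_boot all_order all_algebra.
From mathcomp Require Import all_classical all_reals all_analysis.
From mathcomp Require Import measurable_realfun.
Import Order.TTheory GRing.Theory Num.Theory.
Import numFieldNormedType.Exports.
Local Open Scope classical_set_scope.
Local Open Scope ring_scope.

(** On cdf_range G the quantile q = quantile G alpha satisfies CDF G q = alpha,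
    so G gives mass 1 - alpha to ]q, +oo[ and mass alpha to ]-oo, q].  The
    elementary score with threshold q is alpha on ]q, +oo[ when the forecast
    is at most q, 1 - alpha on ]-oo, q] when it exceeds q, and 0 elsewhere.
    Either way its expectation under G is alpha * (1 - alpha), whatever the
    forecast ([expected_elementary_score]).  Integrating over alpha and
    exchanging the two integrals gives the result.

    The exchange is the delicate point, since mu need not be sigma-finite.
    The finiteness of one expected score makes mu sigma-finite on cdf_range G
    ([sigma_finite_cdf_range]), and Tonelli's theorem then applies to the
    restriction of mu ([tonelli_sigma_finite_on]); it also yields the
    measurability of the score in the observation, which is not known
    beforehand.  For sigma-finiteness, let Y be the set of observations with
    finite score.  Both ]q, +oo[ and ]-oo, q] have positive mass, so Y meets
    both ([ge0_integral_lty_exists]).  A sequence w in Y that is coinitial and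
    cofinal in Y ([coterminal_seq]) therefore takes, for every alpha, a value
    at which the integrand is positive.  Hence cdf_range G is covered by the
    sets where the integrand at w n is at least 1 / (m + 1), and these have
    finite measure by Markov's inequality
    ([sigma_finite_integral_cover]). *)

(** * Sequences reaching the ends of a set of reals *)

(** A set without a minimum is treated by choosing, for each rational, an
    element of the set below it whenever there is one. *)
Lemma coinitial_seq {R : realType} (E : set R) : E !=set0 ->
  exists u : nat -> R, (forall n, E (u n)) /\
    forall y, E y -> exists n, u n <= y.
Proof.
move=> [y0 Ey0].
have [[m [Em mE]]|nomin] := pselect (exists m, E m /\ lbound E m).
  by exists (fun=> m); split => // y Ey; exists 0%N; exact: mE.
have below y : E y -> exists2 z, E z & z < y.
  move=> Ey; apply: contrapT => noz; apply: nomin; exists y; split=> // z Ez.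
  by rewrite leNgt; apply/negP => zy; apply: noz; exists z.
have /choice[u uP] : forall n : nat, exists t : R, E t /\
    forall q : rat, unpickle n = Some q ->
    (exists2 z, E z & z < ratr q) -> t < ratr q.
  move=> n; case: (unpickle n) => [q|]; last by exists y0.
  have [[z Ez zq]|noz] := pselect (exists2 z, E z & z < ratr q).
    by exists z; split=> // _ [<-].
  by exists y0; split => // _ [<-] /noz.
exists u; split=> [n|y /below[z Ez zy]]; first exact: (uP n).1.
have [q] := rat_in_itvoo zy; rewrite in_itv/= => /andP[zq qy].
exists (pickle q); apply/ltW/(lt_trans _ qy).
by apply: (uP _).2; [exact: pickleK|exists z].
Qed.

Lemma cofinal_seq {R : realType} (E : set R) : E !=set0 ->
  exists u : nat -> R, (forall n, E (u n)) /\
    forall y, E y -> exists n, y <= u n.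
Proof.
move=> [y0 Ey0]; have [|v [Ev vP]] := @coinitial_seq _ [set y | E (- y)].
  by exists (- y0); rewrite /= opprK.
exists (fun n => - v n); split => // y Ey.
have /vP[n vn] : [set z | E (- z)] (- y) by rewrite /= opprK.
by exists n; rewrite lerNr.
Qed.

Lemma coterminal_seq {R : realType} (E : set R) : E !=set0 ->
  exists w : nat -> R, (forall n, E (w n)) /\
    forall y, E y -> (exists n, w n <= y) /\ (exists n, y <= w n).
Proof.
move=> E0; have [u [Eu uP]] := coinitial_seq E E0.
have [v [Ev vP]] := cofinal_seq E E0.
(* The even terms are cofinal in E, the odd ones coinitial. *)
exists (fun n => if odd n then u n./2 else v n./2); split => [n|y Ey].
  by case: odd.
have [[n un] [m vm]] := (uP y Ey, vP y Ey); split.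
  by exists n.*2.+1; rewrite /= odd_double/= uphalf_double.
by exists m.*2; rewrite odd_double doubleK.
Qed.

(** * Integrals and sigma-finiteness *)

(** A form of Markov's inequality.  The larger function g need not be
    measurable, because the integral of a nonnegative function is a supremum
    over the simple functions below it. *)
Lemma mule_le_integral {d} {T : measurableType d} {R : realType}
    (mu : {measure set T -> \bar R}) (D W : set T) (g : T -> \bar R)
    (a : \bar R) :
  measurable W -> W `<=` D -> (0 <= a)%E ->
  (forall x, D x -> (0 <= g x)%E) -> (forall x, W x -> (a <= g x)%E) ->
  (a * mu W <= \int[mu]_(x in D) g x)%E.
Proof.
move=> mW WD a0 g0 ag; rewrite -integral_cst// !ge0_integralE//.
apply: ereal_sup_le => _ [h /= hW <-]; exists h => //= x.
apply: (le_trans (hW x)); rewrite !patchE; case: ifPn => [|_].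
  by rewrite inE => Wx; rewrite mem_set; [exact: ag|exact: WD].
by case: ifPn => //; rewrite inE; exact: g0.
Qed.

(** Since g need not be measurable, this cannot be derived from the fact that
    an integrable function is finite almost everywhere. *)
Lemma ge0_integral_lty_exists {d} {T : measurableType d} {R : realType}
    (mu : {measure set T -> \bar R}) (D W : set T) (g : T -> \bar R) :
  measurable W -> W `<=` D -> (0 < mu W)%E ->
  (forall x, D x -> (0 <= g x)%E) -> (\int[mu]_(x in D) g x < +oo)%E ->
  exists2 x, W x & (g x < +oo)%E.
Proof.
move=> mW WD muW g0; apply: contraPP => noz; apply/negP; rewrite -leNgt.
rewrite -(gt0_mulye muW); apply: mule_le_integral => // x Wx.
by rewrite leNgt; apply/negP => gx; apply: noz; exists x.
Qed.

(** A set is sigma-finite when countably many nonnegative measurable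
    functions of finite integral have no common zero in it. *)
Lemma sigma_finite_integral_cover {d} {T : measurableType d} {R : realType}
    (mu : {measure set T -> \bar R}) (D : set T) (g : nat -> T -> R) :
  measurable D -> (forall n, measurable_fun D (g n)) ->
  (forall n x, D x -> 0 <= g n x) ->
  (forall n, (\int[mu]_(x in D) (g n x)%:E < +oo)%E) ->
  (forall x, D x -> exists n, 0 < g n x) -> sigma_finite D mu.
Proof.
move=> mD mg g0 gfin gpos.
pose F (i : nat * nat) := D `&` [set x | i.2.+1%:R^-1 <= g i.1 x].
have mF i : measurable (F i).
  by rewrite /F -preimage_itvcy; apply: mg => //; exact: measurable_itv.
have Ffin i : (mu (F i) < +oo)%E.
  have : ((i.2.+1%:R^-1)%:E * mu (F i) < +oo)%E.
    apply: le_lt_trans (gfin i.1); apply: mule_le_integral => //.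
    - by move=> x [].
    - by move=> x Dx; rewrite lee_fin g0.
    - by move=> x [_ /= ?]; rewrite lee_fin.
  case: (mu (F i)) => [r||]; rewrite ?ltry// => h.
  by rewrite gt0_muley ?lte_fin in h.
exists (fun k => if unpickle k is Some i then F i else set0).
- apply/seteqP; split=> [x Dx|x [k _]].
  + have [n gn] := gpos x Dx.
    have [m nm] : exists m : nat, m.+1%:R^-1 <= g n x.
      exists (Num.trunc (g n x)^-1).
      by rewrite invf_ple ?posrE// ltW// truncnS_gt.
    by exists (pickle (n, m)) => //; rewrite pickleK.
  + by case: unpickle => // i [].
- by move=> k; case: unpickle => [i|//]; split=> //; rewrite measure0.
Qed.

(** Tonelli's theorem on a rectangle D `*` E, where mu is sigma-finite on D
    only. *)
Lemma tonelli_sigma_finite_on {d1 d2} {X : measurableType d1}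
    {Y : measurableType d2} {R : realType} (mu : {measure set X -> \bar R})
    (nu : {sigma_finite_measure set Y -> \bar R}) (D : set X) (E : set Y)
    (f : X * Y -> \bar R) :
  measurable D -> measurable E -> sigma_finite D mu ->
  measurable_fun (D `*` E) f ->
  (forall p, (D `*` E) p -> (0 <= f p)%E) ->
  measurable_fun E (fun y => \int[mu]_(x in D) f (x, y))%E /\
  (\int[nu]_(y in E) \int[mu]_(x in D) f (x, y) =
   \int[mu]_(x in D) \int[nu]_(y in E) f (x, y))%E.
Proof.
move=> mD mE [F DF Ffin] mf f0.
(* Tonelli's theorem is applied to the restriction of mu to D; the complement
   of D, null for it, is added to the cover as the set of index 0. *)
have sfD : sigma_finite [set: X] (mrestr mu mD).
  exists (fun n => if n is k.+1 then F k else ~` D).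
    apply/seteqP; split => // x _; have [|Dx] := pselect (D x).
      by rewrite [X in X x]DF => -[k _ Fx]; exists k.+1.
    by exists 0%N.
  case=> [|n]; rewrite /mrestr.
    by rewrite setICl measure0; split => //; exact: measurableC.
  have [mF muF] := Ffin n; split => //; apply: le_lt_trans muF.
  by apply: measureIl.
pose m : {sigma_finite_measure set X -> \bar R} :=
  HB.pack (mrestr mu mD) (Measure_isSigmaFinite.Build _ _ _ (mrestr mu mD) sfD).
have mE_ g : (\int[mu]_(x in D) g x = \int[m]_(x in D) g x)%E.
  apply: eq_measure_integral => A mA AD.
  by rewrite /= /mrestr setIidl.
pose h := f \_ (D `*` E).
have mh : measurable_fun setT h.
  by apply/(measurable_restrictT _ _).1 => //; exact: measurableX.
have h0 p : (0 <= h p)%E by exact: erestrict_ge0.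
have hy x : D x -> (\int[nu]_(y in E) f (x, y) = \int[nu]_y h (x, y))%E.
  move=> Dx; rewrite integral_mkcond; apply: eq_integral => y _.
  rewrite /h !patchE; congr (if _ then _ else _).
  by apply/idP/idP; rewrite !inE => // -[].
have h0x x y : ~ D x -> h (x, y) = 0%E.
  by move=> Dx; rewrite /h patchE memNset// => -[].
have hx y : E y -> (\int[mu]_(x in D) f (x, y) = \int[m]_x h (x, y))%E.
  move=> Ey; rewrite mE_ integral_mkcond; apply: eq_integral => x _.
  rewrite /h !patchE; congr (if _ then _ else _).
  by apply/idP/idP; rewrite !inE => // -[].
have h0y y : ~ E y -> (\int[m]_x h (x, y) = 0)%E.
  move=> Ey; apply: integral0_eq => x _.
  by rewrite /h patchE memNset// => -[].
split.
  apply: (@eq_measurable_fun _ _ _ _ E (fun y => \int[m]_x h (x, y))%E).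
    by move=> y; rewrite inE => Ey; rewrite hx.
  apply: measurable_funTS.
  exact: (measurable_fun_fubini_tonelli_G h mh h0).
transitivity (\int[nu]_y \int[m]_x h (x, y))%E.
  rewrite integral_mkcond; apply: eq_integral => y _; rewrite patchE.
  by case: ifPn => [|/negP]; rewrite inE => Ey; [rewrite hx|rewrite h0y].
rewrite -fubini_tonelli// mE_ [RHS]integral_mkcond.
apply: eq_integral => x _; rewrite patchE.
case: ifPn => [|/negP]; rewrite inE => Dx; first by rewrite hy.
by apply: integral0_eq => y _; exact: h0x.
Qed.

(** * Distribution functions and quantiles *)

Lemma CDF_fin {R : realType} (F : distr R) z :
  (CDF F z)%:E = F `]-oo, z]%classic.
Proof. by rewrite /CDF fineK// fin_num_measure. Qed.

Lemma CDF_nondecreasing {R : realType} (F : distr R) :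
  {homo CDF F : x y / x <= y}.
Proof.
move=> x y xy; rewrite -lee_fin !CDF_fin; apply: le_measure; rewrite ?inE//.
by apply: subset_itvl; rewrite bnd_simp.
Qed.

(** The quantile function and the distribution function form a Galois
    connection. *)
Lemma quantile_le {R : realType} (F : distr R) (alpha z : R) :
  0 < alpha < 1 -> (quantile F alpha <= z) = (alpha <= CDF F z).
Proof.
move=> /(quantile_min F)[aq qmin]; apply/idP/idP => [qz|/qmin//].
exact: le_trans aq (CDF_nondecreasing F _ _ qz).
Qed.

Lemma CDF_quantile {R : realType} (G : distr R) (alpha : R) :
  cdf_range G alpha -> CDF G (quantile G alpha) = alpha.
Proof.
move=> [a01 [z za]]; apply/eqP; rewrite eq_le (quantile_min G a01).1 andbT.
by rewrite -[leRHS]za CDF_nondecreasing// (quantile_min G a01).2// za.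
Qed.

Lemma measurable_CDF {R : realType} (F : distr R) : measurable_fun setT (CDF F).
Proof. exact: (nondecreasing_measurable measurableT (CDF_nondecreasing F)). Qed.

Lemma measurable_quantile {R : realType} (F : distr R) :
  measurable_fun (`]0, 1[%classic : set R) (quantile F).
Proof.
move=> m01; apply: (measurability (@RGenOInfty.G R)) => //.
  exact: RGenOInfty.measurableE.
move=> _ [_ [z ->] <-].
rewrite (_ : _ `&` _ = `]0, 1[ `&` `]CDF F z, +oo[); first exact: measurableI.
apply/seteqP; split=> a [/= a01]; rewrite !in_itv/= !andbT !ltNge in a01 *.
  by rewrite quantile_le//; move: a01; rewrite -!ltNge.
by rewrite quantile_le//; move: a01; rewrite -!ltNge.
Qed.

Lemma cdf_range_sub {R : realType} (G : distr R) :
  cdf_range G `<=` `]0, 1[%classic.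
Proof. by move=> a [a01 _]; rewrite /= in_itv. Qed.

(** A level alpha in ]0, 1[ belongs to the range of CDF G exactly when
    CDF G (quantile G alpha) = alpha. *)
Lemma measurable_cdf_range {R : realType} (G : distr R) :
  measurable (cdf_range G).
Proof.
have mG : measurable_fun (`]0, 1[%classic : set R) (CDF G \o quantile G).
  exact: measurableT_comp (measurable_CDF G) (measurable_quantile G).
have := measurable_fun_eqr mG (@measurable_id _ _ _).
move=> /(_ (measurable_itv _) [set true] I).
rewrite (_ : _ `&` _ = cdf_range G)//; apply/seteqP; split=> a /=.
  by rewrite in_itv/= => -[a01 /eqP aE]; split => //; exists (quantile G a).
move=> aG; rewrite CDF_quantile// eqxx; split=> //.
exact: (cdf_range_sub G a aG).
Qed.

(** For a fixed forecast x the score is a multiple of the indicator of one of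
    the two half-lines cut at theta. *)
Lemma elementary_scoreE {R : realType} (alpha theta x y : R) :
  elementary_score alpha theta x y =
  if x <= theta then alpha * (theta < y)%R%:R
  else (1 - alpha) * (y <= theta)%R%:R.
Proof.
rewrite /elementary_score; case: (leP x theta) => [xt|tx] /=.
  case: (ltP theta y) => [ty|_] /=; last by rewrite !mulr0n subrr !mulr0.
  rewrite ltNge (le_trans xt (ltW ty)) /= !(mulr0n, mulr1n).
  by rewrite !sub0r mulrN1 opprK mulr1.
case: (ltP theta y) => [_|yt] /=.
  by rewrite !(mulr0n, mulr1n) subrr !mulr0.
by rewrite (le_lt_trans yt tx) !(mulr0n, mulr1n) subr0 !mulr1.
Qed.

Lemma elementary_score_ge0 {R : realType} (alpha theta x y : R) :
  0 < alpha < 1 -> 0 <= elementary_score alpha theta x y.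
Proof.
move=> /andP[a0 a1]; rewrite elementary_scoreE.
by case: ifP => _; rewrite mulr_ge0// ?subr_ge0 ltW.
Qed.

Lemma measurable_elementary_score {R : realType} (D E : set R)
    (theta x : R -> R) :
  measurable D -> measurable E -> measurable_fun D theta ->
  measurable_fun D x ->
  measurable_fun (D `*` E)
    (fun p : R * R => elementary_score p.1 (theta p.1) (x p.1) p.2).
Proof.
move=> mD mE mt mx.
have mlt (f g : R * R -> R) : measurable_fun (D `*` E) f ->
    measurable_fun (D `*` E) g ->
    measurable_fun (D `*` E) (fun p => (f p < g p)%R%:R : R).
  move=> mf mg; apply: (measurableT_comp (f := fun b : bool => b%:R : R)) => //.
  exact: measurable_fun_ltr.
have fstD (f : R -> R) : measurable_fun D f ->
    measurable_fun (D `*` E) (fun p : R * R => f p.1).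
  move=> mf; apply: (measurable_comp mD) => //; last exact: measurable_funTS.
  by move=> _ [p [Dp _] <-].
apply: measurable_funM.
  apply: measurable_funB; last by apply: measurable_funTS.
  by apply: mlt; [exact: measurable_funTS|exact: fstD].
apply: measurable_funB; apply: mlt; try exact: fstD.
exact: measurable_funTS.
Qed.

(** * Expected scores *)

Lemma concentrated_setI {R : realType} (m : borel_measure R) (A B : set R) :
  measurable A -> measurable B -> concentrated_on m A -> m (A `&` B) = m B.
Proof.
move=> mA mB mA0; have mBA0 : m (B `\` A) = 0%E.
  apply: subset_measure0 mA0; [exact: measurableD|exact: measurableC|].
  by move=> x [].
by rewrite setIC [RHS](measureDI m mB mA) [X in (X + _)%E]mBA0 add0e.
Qed.

Lemma mass_above_quantile {R : realType} (I : interval R) (G : distr R)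
    (alpha : R) : distributions_on I G -> cdf_range G alpha ->
  G ([set` I] `&` `]quantile G alpha, +oo[) = (1 - alpha)%:E.
Proof.
move=> GI aG; rewrite concentrated_setI//.
have -> : `]quantile G alpha, +oo[%classic =
    ~` `]-oo, quantile G alpha]%classic by rewrite setCitvl.
by rewrite [LHS](probability_setC G)// -CDF_fin CDF_quantile.
Qed.

Lemma mass_below_quantile {R : realType} (I : interval R) (G : distr R)
    (alpha : R) : distributions_on I G -> cdf_range G alpha ->
  G ([set` I] `&` `]-oo, quantile G alpha]) = alpha%:E.
Proof.
move=> GI aG; rewrite concentrated_setI//.
by rewrite -[in RHS](CDF_quantile G alpha)// CDF_fin.
Qed.

Lemma expected_elementary_score {R : realType} (I : interval R) (G : distr R)
    (alpha x : R) : distributions_on I G -> cdf_range G alpha ->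
  (\int[G]_(y in [set` I])
     (elementary_score alpha (quantile G alpha) x y)%:E =
   (alpha * (1 - alpha))%:E)%E.
Proof.
move=> GI aG; have /andP[a0 a1] := aG.1.
have integral_cst_indic (c : R) (A : set R) : 0 <= c -> measurable A ->
    (\int[G]_(y in [set` I]) (c * \1_A y)%:E = c%:E * G ([set` I] `&` A))%E.
  move=> c0 mA; under eq_integral do rewrite EFinM.
  rewrite ge0_integralZl_EFin//.
  - by rewrite integral_indic// setIC.
  - by apply/measurable_EFinP; exact: measurable_funTS.
under eq_integral do rewrite elementary_scoreE.
case: (leP x) => _.
  rewrite EFinM -(mass_above_quantile I G alpha)// -integral_cst_indic ?ltW//.
  by apply: eq_integral => y _; rewrite indicE mem_setE in_itv/= andbT.
rewrite mulrC EFinM -(mass_below_quantile I G alpha)//.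
rewrite -integral_cst_indic ?subr_ge0 ?ltW//.
by apply: eq_integral => y _; rewrite indicE mem_setE in_itv.
Qed.

Lemma GDS_ge0 {R : realType} (G : distr R) (mu : borel_measure R)
    (F : distr R) (y : R) : (0 <= GDS G mu F y)%E.
Proof.
by apply: integral_ge0 => a [a01 _]; rewrite lee_fin elementary_score_ge0.
Qed.

Lemma measurable_GDS_integrand {R : realType} (G F : distr R) (E : set R) :
  measurable E ->
  measurable_fun (cdf_range G `*` E)
    (fun p : R * R =>
       elementary_score p.1 (quantile G p.1) (quantile F p.1) p.2).
Proof.
move=> mE; have mq (H : distr R) : measurable_fun (cdf_range G) (quantile H).
  apply: measurable_funS (measurable_quantile H) => //.
  exact: cdf_range_sub.
by apply: measurable_elementary_score => //; exact: measurable_cdf_range.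
Qed.

(** Finiteness of a single expected score suffices, with no assumption on
    mu. *)
Lemma sigma_finite_cdf_range {R : realType} (I : interval R) (G F : distr R)
    (mu : borel_measure R) :
  distributions_on I G ->
  (\int[G]_(y in [set` I]) GDS G mu F y < +oo)%E ->
  sigma_finite (cdf_range G) mu.
Proof.
move=> GI GDSfin; have mD := measurable_cdf_range G.
pose Y := [set y | [set` I] y /\ (GDS G mu F y < +oo)%E].
have above a : cdf_range G a -> exists2 y, Y y & quantile G a < y.
  move=> aG; have /andP[_ a1] := aG.1.
  have massW : (0 < G ([set` I] `&` `]quantile G a, +oo[))%E.
    by rewrite mass_above_quantile// lte_fin subr_gt0.
  have [||//||y [Iy]] := @ge0_integral_lty_exists _ _ _ G [set` I]
    ([set` I] `&` `]quantile G a, +oo[) _ _ _ _ _ GDSfin.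
  - exact: measurableI.
  - by move=> y [].
  - by move=> y _; exact: GDS_ge0.
  - by rewrite /= in_itv/= andbT => qy yfin; exists y.
have below a : cdf_range G a -> exists2 y, Y y & y <= quantile G a.
  move=> aG; have /andP[a0 _] := aG.1.
  have massW : (0 < G ([set` I] `&` `]-oo, quantile G a]))%E.
    by rewrite mass_below_quantile.
  have [||//||y [Iy]] := @ge0_integral_lty_exists _ _ _ G [set` I]
    ([set` I] `&` `]-oo, quantile G a]) _ _ _ _ _ GDSfin.
  - exact: measurableI.
  - by move=> y [].
  - by move=> y _; exact: GDS_ge0.
  - by rewrite /= in_itv/= => qy yfin; exists y.
(* A level is needed to know that Y is nonempty. *)
have [[a0 a0G]|D0] := pselect (cdf_range G !=set0); last first.
  exists (fun=> set0) => [|n]; last by rewrite measure0.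
  by rewrite bigcup0//; apply/seteqP; split=> [a aG|//]; case: D0; exists a.
have [w [Yw wP]] : exists w : nat -> R, (forall n, Y (w n)) /\
    forall y, Y y -> (exists n, w n <= y) /\ (exists n, y <= w n).
  by apply: coterminal_seq; have [y Yy _] := above a0 a0G; exists y.
apply: (@sigma_finite_integral_cover _ _ _ mu (cdf_range G)
  (fun n a => elementary_score a (quantile G a) (quantile F a) (w n))) => //.
- move=> n; apply: (measurable_comp
    (F := cdf_range G `*` [set` I]) (g := fun a : R => (a, w n))
    (f := fun p : R * R =>
       elementary_score p.1 (quantile G p.1) (quantile F p.1) p.2)).
  + exact: measurableX.
  + by move=> _ [a aG <-]; split => //; exact: (Yw n).1.
  + exact: measurable_GDS_integrand.
  + by apply: measurable_funTS; exact: measurable_fun_pair.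
- by move=> n a [a01 _]; exact: elementary_score_ge0.
- by move=> n; exact: (Yw n).2.
- move=> a aG; have /andP[a0' a1] := aG.1.
  have [y Yy qy] := above a aG; have [_ [n yn]] := wP y Yy.
  have [z Yz zq] := below a aG; have [[m mz] _] := wP z Yz.
  have [xq|qx] := leP (quantile F a) (quantile G a).
    by exists n; rewrite elementary_scoreE xq (lt_le_trans qy yn) mulr1.
  exists m; rewrite elementary_scoreE leNgt qx/= (le_trans mz zq) mulr1.
  by rewrite subr_gt0.
Qed.

Theorem theorem1 (R : realType) (I : interval R) (G : distr R)
    (mu : borel_measure R) (P0 : set (distr R)) :
  distributions_on I G ->
  concentrated_on mu `]0, 1[%classic ->
  P0 `<=` distributions_on I ->
  (forall F, P0 F -> (\int[G]_(y in [set` I]) GDS G mu F y < +oo)%E) ->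
  exists c : R,
    equitable_with P0 [set` I] (GDS G mu) G c /\
    (P0 !=set0 ->
     c%:E = (\int[mu]_(alpha in cdf_range G) (alpha * (1 - alpha))%:E)%E).
Proof.
move=> GI _ _ GDSfin.
pose c : \bar R := (\int[mu]_(alpha in cdf_range G) (alpha * (1 - alpha))%:E)%E.
have GDSc F : P0 F -> measurable_fun [set` I] (GDS G mu F) /\
    (\int[G]_(y in [set` I]) GDS G mu F y = c)%E.
  move=> /GDSfin Ffin; have sfD := sigma_finite_cdf_range I G F mu GI Ffin.
  have [|//|||mGDS ->] := @tonelli_sigma_finite_on _ _ _ _ _ mu G (cdf_range G)
    [set` I] (fun p => (elementary_score p.1 (quantile G p.1)
                                        (quantile F p.1) p.2)%:E) _ _ sfD.
  - exact: measurable_cdf_range.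
  - by apply/measurable_EFinP; exact: measurable_GDS_integrand.
  - by move=> p [[p01 _] _]; rewrite lee_fin elementary_score_ge0.
  split=> //; apply: eq_integral => a; rewrite inE => aG.
  exact: (expected_elementary_score I G a (quantile F a) GI aG).
have cfin F : P0 F -> (fine c)%:E = c.
  move=> P0F; rewrite fineK// ge0_fin_numE.
    by rewrite -(GDSc F P0F).2; exact: GDSfin.
  by rewrite -(GDSc F P0F).2; apply: integral_ge0 => y _; exact: GDS_ge0.
exists (fine c); split=> [F P0F|[F P0F]]; last exact: (cfin F).
have [mF intF] := GDSc F P0F; split; last by rewrite intF (cfin F).
apply/integrableP; split=> //; under eq_integral do rewrite gee0_abs ?GDS_ge0//.
exact: GDSfin.
Qed.
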